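(* Let $\ell\in\mathbb{N}$, and let $\mathbb{E}[\ell]=\frac{1}{2^\ell}\sum_{\mathbf{b}\in B_\ell} r(\mathbf{b})$ be the expected length of the right lane of a uniformly random arrival sequence of length $\ell$. If $\ell$ is odd, then $$\mathbb{E}[\ell]=\frac{\ell}{2^\ell}\left(2^{\ell-1}+\binom{\ell-1}{(\ell-1)/2}\right).$$ If $\ell$ is even, then $$\mathbb{E}[\ell]=\frac{\ell}{2^{\ell+1}}\left(2^\ell+\binom{\ell}{\ell/2}\right).$$
   Context: An arrival sequence of length $\ell$ is a binary string $\mathbf{b}=b_1b_2\cdots b_\ell\in\{0,1\}^\ell$; $B_\ell$ is the set of all of them. Cars $1,2,\dots,\ell$ arrive in order and choose between two initially empty lanes (left and right): if $b_i=0$, car $i$ enters the right lane; if $b_i=1$, car $i$ enters the currently shorter lane, and enters the right lane if both lanes have the same length. $r(\mathbf{b})$ denotes the final number of cars in the right lane. *)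

(* Defs.v *)
From mathcomp Require Import all_boot all_order all_algebra.

Set Implicit Arguments.
Unset Strict Implicit.
Unset Printing Implicit Defensive.

Import Order.TTheory GRing.Theory Num.Theory.

(* Numbers of cars in the (left, right) lanes. *)
Definition lanes : Type := (nat * nat)%type.

Definition enter_left (s : lanes) : lanes := (s.1.+1, s.2).
Definition enter_right (s : lanes) : lanes := (s.1, s.2.+1).

(* [true] is the bit 1 (shorter lane, right on a tie), [false] the bit 0. *)
Definition park (s : lanes) (b : bool) : lanes :=
  if b then (if s.1 < s.2 then enter_left s else enter_right s)
  else enter_right s.

Definition final_lanes (b : seq bool) : lanes := foldl park (0, 0) b.

Definition right_length (b : seq bool) : nat := (final_lanes b).2.

Definition expected_right (l : nat) : rat :=
  (1 / 2 ^+ l * \sum_(b : l.-tuple bool) (right_length b)%:R)%R.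

(* Main.v *)
(** Send each car left or right independently instead.  Exchanging the names of
    the lanes whenever they are tied turns the parking process into this one,
    with the right lane corresponding to the longer lane; hence the total of
    [r] over all sequences is the sum of [C(l, i) * max(i, l - i)].  The
    absorption identities [C(l, i) * (l - i) = l * C(l-1, i)] and
    [C(l, i) * i = l * C(l-1, i-1)] evaluate the two halves of that sum, and the
    central coefficient of row [l-1] is the only one counted twice. *)
Require Import Defs.
From mathcomp Require Import all_boot all_order all_algebra.
From mathcomp Require Import zify ring.

Import Order.TTheory GRing.Theory Num.Theory.
Local Open Scope ring_scope.

Lemma sum_tuple_cons (T : finType) (n : nat) (F : seq T -> nat) :
  (\sum_(b : n.+1.-tuple T) F b = \sum_x \sum_(b : n.-tuple T) F (x :: b))%N.
Proof.
rewrite pair_big /=.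
rewrite (reindex (fun p : T * n.-tuple T => [tuple of p.1 :: p.2])) //=.
exists (fun t : n.+1.-tuple T => (thead t, [tuple of behead t])) => [[x t] _|t _].
  by congr pair; apply: val_inj.
by rewrite -tuple_eta.
Qed.

(** Pascal's rule, in the form that mirrors conditioning on the first car of a sequence. *)
Lemma sum_bin_recr (n : nat) (f : nat -> nat) :
  (\sum_(i < n.+2) 'C(n.+1, i) * f i =
   \sum_(i < n.+1) 'C(n, i) * f i + \sum_(i < n.+1) 'C(n, i) * f i.+1)%N.
Proof.
rewrite big_ord_recl [X in (_ = X + _)%N]big_ord_recl /= !bin0 -addnA.
congr addn; rewrite (eq_bigr (fun i : 'I_n.+1 =>
  'C(n, i.+1) * f i.+1 + 'C(n, i) * f i.+1)%N); last first.
  by move=> i _; rewrite /bump /= add1n binS mulnDl.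
rewrite big_split /=; congr addn.
by rewrite big_ord_recr /= bin_small // mul0n addn0.
Qed.

Lemma sum_bin_rev (n : nat) (f : nat -> nat) :
  (\sum_(i < n.+1) 'C(n, i) * f i = \sum_(i < n.+1) 'C(n, i) * f (n - i))%N.
Proof.
rewrite (reindex_inj rev_ord_inj) /=; apply: eq_bigr => i _.
by rewrite subSS bin_sub // -ltnS.
Qed.

(** Induction on the first car needs arbitrary initial lanes; [a <= c] is an invariant, since a tie
    always sends the car right. *)
Lemma sum_park (n a c : nat) : (a <= c)%N ->
  (\sum_(b : n.-tuple bool) (foldl park (a, c) b).2 =
   \sum_(i < n.+1) 'C(n, i) * maxn (a + i) (c + (n - i)))%N.
Proof.
elim: n a c => [|n IHn] a c le_ac.
  rewrite big_ord1 (eq_bigr (fun=> c)) => [|b _]; last by rewrite tuple0.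
  by rewrite sum_nat_const card_tuple expn0 bin0 /=; lia.
rewrite (sum_tuple_cons _ _ (fun b => (foldl park (a, c) b).2)) big_bool /=.
rewrite (sum_bin_recr _ (fun i => maxn (a + i) (c + (n.+1 - i)))) /=.
rewrite /park /enter_left /enter_right /= -/park addnC.
rewrite IHn ?leqW //; congr addn.
  by apply: eq_bigr => i _; rewrite subSn -1?ltnS // addnS.
case: ltnP => [lt_ac|le_ca].
  by rewrite IHn //; apply: eq_bigr => i _; rewrite addSnnS.
(* At a tie both bits lead to [(a, a.+1)]. Reflecting [i] to [n - i] in one of the two copies
   exchanges the lanes and gives the missing term. *)
have <-: a = c by lia.
rewrite IHn // (sum_bin_rev _ (fun i => maxn (a + i) (a.+1 + (n - i)))).
apply: eq_bigr => i _; congr (_ * _)%N; have := ltn_ord i; lia.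
Qed.

Lemma sum_bin_max (n : nat) :
  (\sum_(i < n.+2) 'C(n.+1, i) * maxn i (n.+1 - i) =
   n.+1 * (2 ^ n + 'C(n, n./2)))%N.
Proof.
have le_mn : (n./2 <= n)%N by lia.
rewrite -(big_mkord predT (fun i => 'C(n.+1, i) * maxn i (n.+1 - i)))%N.
(* [n./2] is the last [i] with [i <= n.+1 - i], so each range has a fixed maximum. *)
rewrite (big_cat_nat (n := n./2.+1)) //=; last by lia.
have -> : (\sum_(0 <= i < n./2.+1) 'C(n.+1, i) * maxn i (n.+1 - i) =
           n.+1 * \sum_(0 <= i < n./2.+1) 'C(n, i))%N.
  rewrite big_distrr /= !big_nat; apply: eq_bigr => i /andP[_ lt_im].
  have -> : maxn i (n.+1 - i) = (n.+1 - i)%N by lia.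
  by rewrite mulnC -mul_bin_down.
have -> : (\sum_(n./2.+1 <= i < n.+2) 'C(n.+1, i) * maxn i (n.+1 - i) =
           n.+1 * \sum_(n./2 <= i < n.+1) 'C(n, i))%N.
  rewrite big_add1 big_distrr /= !big_nat; apply: eq_bigr => i /andP[le_mi _].
  have -> : maxn i.+1 (n.+1 - i.+1) = i.+1 by lia.
  by rewrite mulnC -mul_bin_diag.
(* Absorption has shifted the upper range down by one, so both ranges contain [n./2]; setting one
   copy aside leaves the full row [n]. *)
rewrite -mulnDr big_nat_recr //= -addnA [('C(n, _) + _)%N]addnC addnA.
rewrite -big_cat_nat //=; last by lia.
have := expnDn 1 1 n; rewrite addn1 => ->; rewrite big_mkord.
by congr (_ * (_ + _))%N; apply: eq_bigr => i _; rewrite !exp1n !muln1.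
Qed.

Lemma expected_rightS (n : nat) :
  expected_right n.+1 =
    n.+1%:R / 2 ^+ n.+1 * (2 ^+ n + 'C(n, n./2)%:R).
Proof.
rewrite /expected_right -natr_sum /right_length /final_lanes sum_park //.
rewrite (eq_bigr (fun i : 'I_n.+2 => 'C(n.+1, i) * maxn i (n.+1 - i)))%N //.
by rewrite sum_bin_max natrM natrD natrX mulrA mul1r [_^-1 * _]mulrC.
Qed.

(** The two middle entries of an odd row agree. The factor 2 accounts for the larger denominator in
    the even case. *)
Lemma bin_central (m : nat) : 'C(m.*2.+2, m.+1) = (2 * 'C(m.*2.+1, m))%N.
Proof.
have symm : 'C(m.*2.+1, m) = 'C(m.*2.+1, m.+1).
  by rewrite -(bin_sub (m := m.+1)); [congr ('C(_, _)); lia | lia].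
by rewrite [LHS]binS -symm addnn mul2n.
Qed.

Theorem theorem2p3 (l : nat) :
  (odd l ->
     expected_right l =
       l%:R / 2 ^+ l * (2 ^+ (l - 1) + 'C(l - 1, (l - 1) %/ 2)%:R)) /\
  (~~ odd l ->
     expected_right l =
       l%:R / 2 ^+ l.+1 * (2 ^+ l + 'C(l, l %/ 2)%:R)).
Proof.
case: l => [|n]; split=> // parity_l.
- rewrite /expected_right !mul0r big1 ?mulr0 // => b _.
  by rewrite tuple0.
- by rewrite expected_rightS subn1 divn2.
rewrite expected_rightS divn2.
have [m ->] : exists m, n = m.*2.+1 by exists n./2; lia.
have -> : m.*2.+1./2 = m by lia.
have -> : m.*2.+2./2 = m.+1 by lia.
rewrite bin_central natrM !exprS.
by field; rewrite expf_neq0.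
Qed.
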